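(* Let $\mathbb{C}$ be an initial configuration on $S$ stacks and let $F\cup G$ be a block subset satisfying P8 (with respect to a block $i$ in stack $s$). Then one can always pick exactly $S$ blocks out of $F\cup G$ forming a set that again satisfies P8, by the following procedure: (i) pick a block from stack $s$ (i.e. of $F$) that cannot be relocated to be WP in the verification step; (ii) pick a barrier block of the block picked in (i) from the first of the $S-1$ sorted stacks; (iii) pick a barrier block of the previously picked block from the second of the $S-1$ sorted stacks, and repeat this process until a block is picked from the last of the $S-1$ sorted stacks. (That is, all the required picks are possible, and the set of the $S$ picked blocks satisfies P8.)
   Context: Setting (block relocation problem). There are $S$ stacks and $B$ blocks labelled by $\mathbb{B}=\{1,\dots,B\}$; a smaller label means a higher priority. The initial configuration $\mathbb{C}$ places every block in exactly one stack, each stack being a finite vertical sequence of blocks. In a configuration, a block is badly placed (BP) if some block below it in the same stack has a smaller label; otherwise it is well placed (WP). The priority of a stack is the highest priority (smallest label) of a block in it, and $+\infty$ (the lowest priority) if it is empty. P8: a block set $F\cup G$ satisfies P8 with respect to a block $i$ in stack $s$ if: $F$ consists of blocks above $i$ in stack $s$ with priorities lower than that of $i$; $G$ consists of at most one WP block (with respect to $\mathbb{C}$) from each of the other $S-1$ stacks, each with priority lower than that of $i$; and, after removing from $\mathbb{C}$ all blocks except those of $F\cup G$, in every experiment in which each block of $F$ is relocated exactly once (from top to bottom, each to the top of one of the other $S-1$ stacks, without considering the stack height limit and without moving blocks of $G$), some relocated block fails to become WP. Verification step for $F\cup G$: remove from $\mathbb{C}$ all blocks except those of $F\cup G$. Sort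 the $S-1$ stacks other than $s$ in a non-decreasing order of their priorities, from the lowest priority (empty stacks first) to the highest priority. Then successively, from top to bottom, relocate the blocks of $F$ from stack $s$, ignoring the height limit: if the current block can be placed so as to be WP on at least one of the $S-1$ stacks, relocate it to the one of these stacks with the highest priority, i.e. the last one in the sorted order; if it cannot be relocated to be WP on any of them, stop (this is the block that cannot be relocated to be WP). Barrier blocks: for a block $j\in F$, a barrier block of $j$ is a block $k$ of higher priority than $j$ that is already piled in one of the $S-1$ other stacks at the moment when $j$ is to be relocated in the verification step. For a block $j\in G$, the barrier blocks of $j$ are the blocks of $G$ with priority higher than or equal to that of $j$. *)

(* Defs.v *)
From mathcomp Require Import all_boot.

Set Implicit Arguments.
Unset Strict Implicit.
Unset Printing Implicit Defensive.

(* Blocks are 0-based: [b : 'I_B] stands for the label b + 1, so the order on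
   labels is the one of 'I_B and a smaller label is a higher priority.
   A stack is listed from top to bottom. *)
Definition config (S B : nat) := {ffun 'I_S -> seq 'I_B}.

Section BlockRelocation.
Variables S B : nat.
Implicit Types (c : config S B) (s t : 'I_S) (st : seq 'I_B) (b i j k : 'I_B).
Implicit Types (F G X : {set 'I_B}) (o : seq 'I_S) (p : seq 'I_B).

Definition is_initial c : Prop :=
  forall b, \sum_(t < S) count_mem b (c t) = 1.

Definition above st b : seq 'I_B := take (index b st) st.
Definition below st b : seq 'I_B := drop (index b st).+1 st.

Definition badly_placed c b : bool :=
  [exists t, (b \in c t) && has (fun k => k < b) (below (c t) b)].
Definition well_placed c b : bool := ~~ badly_placed c b.

(* The smallest label in the stack. An empty stack gets B, which exceeds every
   element of 'I_B and plays the role of +oo. *)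
Definition priority st : nat := \big[minn/B]_(b <- st) (b : nat).

Definition restrict c X : config S B := [ffun t => [seq b <- c t | b \in X]].

Definition relocate c b t : config S B :=
  [ffun u => let st := [seq x <- c u | x != b] in if u == t then b :: st else st].

(* An experiment is given by the destination [e b] of each block b of stack s;
   the blocks of stack s down to and including b are relocated in turn. *)
Definition after_relocating c s (e : 'I_B -> 'I_S) b : config S B :=
  foldl (fun c' x => relocate c' x (e x)) c (rcons (above (c s) b) b).

Definition P8 c i s F G : Prop :=
  [/\ i \in c s,
      forall b, b \in F -> b \in above (c s) i /\ i < b,
      forall b, b \in G -> [/\ b \notin c s, well_placed c b & i < b],
      forall t, t != s -> #|[set b in G | b \in c t]| <= 1
    & forall e : 'I_B -> 'I_S, (forall b, b \in F -> e b != s) ->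
        exists2 b, b \in F &
          ~~ well_placed (after_relocating (restrict c (F :|: G)) s e b) b].

(* [o] lists the stacks other than s from the lowest to the highest priority,
   i.e. by non-increasing smallest label; ties are broken arbitrarily. *)
Definition sorted_stacks c s o : Prop :=
  perm_eq o [seq t <- enum 'I_S | t != s] /\
  sorted (fun t u => priority (c u) <= priority (c t)) o.

(* The last stack in [o] on which b becomes well placed, if there is one. *)
Definition destination o c b : option 'I_S :=
  ohead (rev [seq t <- o | well_placed (relocate c b t) b]).

(* The configurations met in the verification step started from [c0]. *)
Inductive verification c0 s o : config S B -> Prop :=
| verification_start : verification c0 s o c0
| verification_next c b t :
    verification c0 s o c -> ohead (c s) = Some b ->
    destination o c b = Some t -> verification c0 s o (relocate c b t).

(* [c] is the configuration at the moment when j is to be relocated. *)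
Definition to_be_relocated c0 s o j c : Prop :=
  verification c0 s o c /\ ohead (c s) = Some j.

(* The verification step stops in configuration [c] because of j. *)
Definition stops_at c0 s o j c : Prop :=
  to_be_relocated c0 s o j c /\ destination o c j = None.

Definition barrier c0 s o F G j k : Prop :=
  [/\ j \in F, k < j
    & exists c t, [/\ to_be_relocated c0 s o j c, t != s & k \in c t]] \/
  [/\ j \in G, k \in G & k <= j].

(* The possible sequences of successive picks. A pick "from" a stack is read in
   the configuration in which the verification step stopped; with n.+1 blocks
   already picked, the next one comes from the stack of index n in [o]. *)
Inductive picks c s F G o : seq 'I_B -> Prop :=
| picks_nil : picks c s F G o [::]
| picks_first j c' :
    stops_at (restrict c (F :|: G)) s o j c' -> picks c s F G o [:: j]
| picks_next p j k j0 c' :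
    picks c s F G o (rcons p j) -> size p < size o ->
    stops_at (restrict c (F :|: G)) s o j0 c' ->
    k \in c' (nth s o (size p)) ->
    barrier (restrict c (F :|: G)) s o F G j k ->
    picks c s F G o (rcons (rcons p j) k).

End BlockRelocation.

(* Main.v *)
Require Import Defs.
From mathcomp Require Import all_boot.

Set Implicit Arguments.
Unset Strict Implicit.
Unset Printing Implicit Defensive.

(* The verification step must stop, since otherwise its destinations would be an
   experiment in which every block of F becomes well placed. The block j where
   it stops has a barrier block on each other stack. A block of F on the n-th
   sorted stack was sent to the last stack where it was well placed, so it has
   a barrier block on the next stack; a block of G has one there because the
   stacks are sorted by priority. So picking never gets stuck.
   The picked labels are non-increasing, and a picked block of F is followed
   only by smaller labels, each lying above it in stack s or belonging to G.
   Hence if all picked blocks of F became well placed, no two picked blocks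
   could end up in the same stack, and S blocks would fit on S - 1 stacks. *)
Definition separated S B (c : config S B) : Prop :=
  (forall t, uniq (c t)) /\ (forall b t u, b \in c t -> b \in c u -> t = u).

Definition run S B (c : config S B) (e : 'I_B -> 'I_S) (q : seq 'I_B) :=
  foldl (fun c' x => relocate c' x (e x)) c q.

Lemma mem_above (T : eqType) (st : seq T) (x y : T) :
  (y \in take (index x st) st) = (y \in st) && (index y st < index x st).
Proof.
case: (boolP (y \in st)) => [/in_take -> //|yst] /=.
by apply/negbTE/(contra _ yst)/mem_take.
Qed.

Lemma take_index_cat (T : eqType) (q r : seq T) (x : T) :
  x \notin q -> take (index x (q ++ x :: r)) (q ++ x :: r) = q.
Proof.
by move=> /negbTE xq; rewrite index_cat xq /= eqxx addn0 take_size_cat.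
Qed.

Lemma cat_take_index (T : eqType) (st : seq T) (x : T) : x \in st ->
  exists2 r, st = take (index x st) st ++ x :: r & x \notin take (index x st) st.
Proof.
move=> xst; exists (drop (index x st).+1 st).
  rewrite -{1}(cat_take_drop (index x st) st) (drop_nth x) ?index_mem //.
  by rewrite nth_index.
by rewrite in_take // ltnn.
Qed.

Section Blocks.
Variables S B : nat.
Implicit Types (c : config S B) (s t u : 'I_S) (st : seq 'I_B) (b j k x : 'I_B).
Implicit Types (o : seq 'I_S) (q : seq 'I_B) (e : 'I_B -> 'I_S) (P : {set 'I_B}).

Lemma is_initial_separated c : is_initial c -> separated c.
Proof.
move=> ic; split=> [t|b t u bt bu].
  apply/count_mem_uniq => b; have := ic b; rewrite (bigD1 t) //= => E.
  have : count_mem b (c t) <= 1 by rewrite -E leq_addr.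
  by rewrite -has_pred1 has_count; case: (count_mem b (c t)) => [|[]].
apply/eqP/contraT => tu; have := ic b.
rewrite (bigD1 t) //= (bigD1 u) 1?eq_sym //=.
move: bt bu; rewrite -!has_pred1 !has_count.
by case: (count_mem b (c t)) (count_mem b (c u)) => [|m] [|n] //; rewrite addSn addnS.
Qed.

Lemma separated_restrict c P : separated c -> separated (restrict c P).
Proof.
move=> [uc dc]; split=> [t|b t u]; first by rewrite ffunE filter_uniq.
by rewrite !ffunE !mem_filter => /andP[_ bt] /andP[_]; apply: dc.
Qed.

Lemma mem_relocate c b t x u :
  (x \in relocate c b t u) = if x == b then u == t else x \in c u.
Proof.
rewrite ffunE; case: (u == t); rewrite ?inE mem_filter /=; by case: (x == b).
Qed.

Lemma separated_relocate c b t : separated c -> separated (relocate c b t).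
Proof.
move=> [uc dc]; split=> [u|x u v].
  by rewrite ffunE /=; case: (u == t); rewrite /= ?mem_filter ?eqxx filter_uniq.
by rewrite !mem_relocate; case: ifP => _; [move=> /eqP-> /eqP-> | apply: dc].
Qed.

Lemma well_placed_relocate c b t :
  well_placed (relocate c b t) b = ~~ has (fun k => k < b) (c t).
Proof.
have belowE : below (relocate c b t t) b = [seq x <- c t | x != b].
  by rewrite /below ffunE eqxx /= eqxx drop0.
congr (~~ _); apply/existsP/hasP => [[u /andP[]]|[k kt kb]].
  rewrite mem_relocate eqxx => /eqP->; rewrite belowE => /hasP[k].
  by rewrite mem_filter => /andP[_ kt] kb; exists k.
exists t; rewrite mem_relocate !eqxx belowE; apply/hasP; exists k => //.
by rewrite mem_filter kt andbT; apply/negP => /eqP kb'; rewrite kb' ltnn in kb.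
Qed.

Lemma after_relocatingE c s e b :
  after_relocating c s e b = relocate (run c e (above (c s) b)) b (e b).
Proof. by rewrite /after_relocating foldl_rcons. Qed.

Lemma destination_rcons o c b t : destination (rcons o t) c b =
  if well_placed (relocate c b t) b then Some t else destination o c b.
Proof. by rewrite /destination filter_rcons; case: ifP; rewrite ?rev_rcons. Qed.

Lemma destination_None o c b t : destination o c b = None -> t \in o ->
  has (fun k => k < b) (c t).
Proof.
elim/last_ind: o => // o u IH; rewrite destination_rcons well_placed_relocate.
case: ifP => // /negbFE wu Eo; rewrite mem_rcons inE => /predU1P[->//|].
exact: IH.
Qed.

Lemma destination_Some o c b t : destination o c b = Some t ->
  exists o1 o2, [/\ o = o1 ++ t :: o2, ~~ has (fun k => k < b) (c t)
    & forall u, u \in o2 -> has (fun k => k < b) (c u)].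
Proof.
elim/last_ind: o => // o u IH; rewrite destination_rcons well_placed_relocate.
case: ifP => [wu [<-]|/negbFE wu /IH[o1 [o2 [-> wt no]]]].
  by exists o, [::]; rewrite cats1.
exists o1, (rcons o2 u); rewrite rcons_cat; split=> // v.
by rewrite mem_rcons inE => /predU1P[->//|]; apply: no.
Qed.

Lemma priority_le st b : b \in st -> priority st <= b.
Proof.
rewrite /priority; elim: st => // x st IH; rewrite inE big_cons geq_min.
by case/predU1P => [->|/IH->]; rewrite ?leqnn ?orbT.
Qed.

Lemma priority_attained st : priority st < B ->
  exists2 b, b \in st & priority st = b.
Proof.
rewrite /priority; elim: st => [|x st IH]; first by rewrite big_nil ltnn.
rewrite big_cons; case: (leqP (x : nat)) => [_ _|_ /IH[b bst ->]].
  by exists x; rewrite ?mem_head.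
by exists b; rewrite // inE bst orbT.
Qed.

Lemma above_filter st P x : x \in st -> x \in P ->
  above [seq b <- st | b \in P] x = [seq b <- above st x | b \in P].
Proof.
move=> xst xP; have [r Est xq] := cat_take_index xst.
rewrite /above {1 2}Est filter_cat /= xP take_index_cat //.
by rewrite mem_filter (negbTE xq) andbF.
Qed.

Lemma run_keep c e q x u : x \in c u -> x \notin q -> x \in run c e q u.
Proof.
elim: q c => //= y q IH c xu; rewrite inE negb_or => /andP[xy xq].
by apply: IH; rewrite // mem_relocate (negbTE xy).
Qed.

Lemma run_moved c e q x : x \in q -> x \in run c e q (e x).
Proof.
elim/last_ind: q => // q y IH; rewrite /run foldl_rcons mem_relocate.
by rewrite mem_rcons inE; case: eqP => [->|_ /IH].
Qed.

Lemma run_eq_in c e e' q : {in q, e =1 e'} -> run c e q = run c e' q.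
Proof.
elim: q c => //= x q IH c E; rewrite (E x) ?mem_head //.
by apply: IH => y yq; apply: E; rewrite inE yq orbT.
Qed.

Lemma run_source c e s q r : uniq (c s) -> c s = q ++ r ->
  {in q, forall b, e b != s} -> run c e q s = r.
Proof.
elim: q c => //= x q IH c us Ec es.
have Es : relocate c x (e x) s = q ++ r.
  rewrite ffunE eq_sym (negbTE (es x _)) ?mem_head // -rem_filter //.
  by rewrite Ec /= eqxx.
apply: IH => //; last by move=> y yq; apply: es; rewrite inE yq orbT.
by rewrite Es; move: us; rewrite Ec => /andP[].
Qed.

Lemma verification_run c s o q r : uniq (c s) -> s \notin o -> c s = q ++ r ->
  (exists j c', stops_at c s o j c') \/
  (exists e, [/\ {in q, forall b, e b != s}, verification c s o (run c e q)
    & {in q, forall b, well_placed (after_relocating c s e b) b}]).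
Proof.
move=> us so; elim/last_ind: q r => [|q x IH] r Ec.
  by right; exists (fun=> s); split=> //; left.
rewrite cat_rcons in Ec.
have [|[e [es ve we]]] := IH _ Ec; first by left.
have Es := run_source us Ec es.
case Ed: (destination o (run c e q) x) => [t|]; last first.
  by left; exists x, (run c e q); split; first split; rewrite ?Es.
have [o1 [o2 [Eo wt _]]] := destination_Some Ed.
have xq : x \notin q.
  by move: us; rewrite Ec cat_uniq /= negb_or => /and3P[_ /andP[]].
pose e' b := if b == x then t else e b.
have e'E q' : {subset q' <= q} -> {in q', e' =1 e}.
  by move=> qq b /qq bq; rewrite /e'; case: eqP bq xq => // -> ->.
have runE : run c e' q = run c e q by apply/run_eq_in/e'E.
have e'x : e' x = t by rewrite /e' eqxx.
right; exists e'; split.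
- move=> b; rewrite mem_rcons inE /e'; case: eqP => [_ _|_ /es//].
  by apply: contraNneq so => <-; rewrite Eo mem_cat mem_head orbT.
- rewrite /run foldl_rcons -/(run c e' q) runE e'x.
  by apply: verification_next ve _ Ed; rewrite Es.
- move=> b; rewrite mem_rcons inE; case: eqP => [-> _|_ /= bq].
    rewrite after_relocatingE well_placed_relocate /above Ec take_index_cat //.
    by rewrite runE e'x.
  have sub : {subset above (c s) b <= q}.
    move=> y; rewrite /above Ec index_cat bq take_cat index_mem bq; exact: mem_take.
  have := we _ bq; rewrite !after_relocatingE (run_eq_in _ (e'E _ sub)).
  by rewrite (e'E q) .
Qed.

(* Every block found outside s either has never moved, or went to its present
   stack from a configuration [c1] of which nothing outside s has moved since. *)
Lemma verification_inv c0 s o c : separated c0 -> s \notin o ->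
  verification c0 s o c ->
  [/\ separated c, exists q, c0 s = q ++ c s
    & forall u, u != s -> {subset c0 u <= c u} /\
      forall x, x \in c u -> x \in c0 u \/ x \in c0 s /\ x \notin c s /\
        exists c1, [/\ to_be_relocated c0 s o x c1, destination o c1 x = Some u
          & forall v, v != s -> {subset c1 v <= c v}]].
Proof.
move=> sc so; elim=> {c} [|c b t vc [sc' [q Eq] inv] hb Ed].
  by split=> //; [exists [::] | move=> u us; split=> // x; left].
have [o1 [o2 [Eo _ _]]] := destination_Some Ed.
have ts : t != s by apply: contraNneq so => <-; rewrite Eo mem_cat mem_head orbT.
have [r Ecs] : exists r, c s = b :: r.
  by case: (c s) hb => // y r [->]; exists r.
have bcs : b \in c s by rewrite Ecs mem_head.
have sub v : v != s -> {subset c v <= relocate c b t v}.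
  move=> vs x xv; rewrite mem_relocate; case: eqP => // xb.
  by case/eqP: vs; apply: (proj2 sc' b); rewrite // -xb.
have Es : relocate c b t s = r.
  rewrite ffunE eq_sym (negbTE ts) -rem_filter; last exact: (proj1 sc').
  by rewrite Ecs /= eqxx.
split; first exact: separated_relocate.
  by exists (rcons q b); rewrite Es cat_rcons -Ecs.
move=> u us; have [sub0 invu] := inv u us; split=> [x /sub0 /(sub u us)//|x].
rewrite {1}mem_relocate; case: eqP => [->{x} /eqP->|xb /invu[|[x0 [xs [c1 [tb Ed1 sub1]]]]]].
- right; split; first by rewrite Eq mem_cat bcs orbT.
  by rewrite mem_relocate eqxx eq_sym; split=> //; exists c.
- by left.
right; split=> //; rewrite mem_relocate; case: eqP => // _; split=> //.
exists c1; split=> // v vs y /(sub1 v vs); exact: sub.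
Qed.
End Blocks.

Section Picks.
Variables (S B : nat) (c : config S B) (i : 'I_B) (s : 'I_S).
Variables (F G : {set 'I_B}) (o : seq 'I_S).
Hypothesis c_init : is_initial c.
Hypothesis FG_P8 : P8 c i s F G.
Hypothesis o_sorted : sorted_stacks (restrict c (F :|: G)) s o.
Let c0 := restrict c (F :|: G).

Let c_sep : separated c. Proof. exact: is_initial_separated. Qed.
Let c0_sep : separated c0. Proof. exact: separated_restrict. Qed.

Let mem_o t : (t \in o) = (t != s).
Proof. by rewrite (perm_mem (proj1 o_sorted)) mem_filter mem_enum andbT. Qed.

Let o_avoids : s \notin o. Proof. by rewrite mem_o eqxx. Qed.

Let o_uniq : uniq o.
Proof. by rewrite (perm_uniq (proj1 o_sorted)) filter_uniq ?enum_uniq. Qed.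

Lemma size_sorted_stacks : (size o).+1 = S.
Proof.
rewrite (perm_size (proj1 o_sorted)) -rem_filter ?enum_uniq //.
rewrite size_rem ?mem_enum // size_enum_ord prednK //.
exact: leq_ltn_trans (ltn_ord s).
Qed.

Let nth_o n : n < size o -> nth s o n != s.
Proof. by move=> no; rewrite -mem_o mem_nth. Qed.

Let F_source b : b \in F -> b \in c s.
Proof. by case: FG_P8 => _ FP _ _ _ /FP[/mem_take]. Qed.

Let G_source b : b \in G -> b \notin c s.
Proof. by case: FG_P8 => _ _ GP _ _ /GP[]. Qed.

Let mem_c0 b t : (b \in c0 t) = (b \in F :|: G) && (b \in c t).
Proof. by rewrite ffunE mem_filter. Qed.

Let mem_c0s b : (b \in c0 s) = (b \in F).
Proof.
rewrite mem_c0 inE; apply/idP/idP => [/andP[/orP[//|/G_source/negP nb] /nb]//|bF].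
by rewrite bF F_source.
Qed.

Let other_G b t : b \in c0 t -> t != s -> b \in G.
Proof.
rewrite mem_c0 inE => /andP[/orP[bF|//] bt] /eqP[].
by apply: (proj2 c_sep) bt _; apply: F_source.
Qed.

Lemma stop_exists : exists j c', stops_at c0 s o j c'.
Proof.
have [//|[e [es _ we]]] :=
  verification_run (proj1 c0_sep s) o_avoids (esym (cats0 (c0 s))).
have es' b : b \in F -> e b != s by rewrite -mem_c0s; apply: es.
have [_ _ _ _ /(_ e es')[b bF]] := FG_P8.
by rewrite we // mem_c0s.
Qed.

Lemma stops_at_source j c' : stops_at c0 s o j c' -> j \in F.
Proof.
move=> [[vc hj] _]; have [_ [q Eq] _] := verification_inv c0_sep o_avoids vc.
by rewrite -mem_c0s Eq mem_cat; case: (c' s) hj => // y r [->]; rewrite mem_head orbT.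
Qed.

(* A block relocated to a stack could not be well placed on any later one of
   the sorted list, and a later stack has at least the priority of an earlier. *)
Lemma next_barrier c' n j : verification c0 s o c' -> n.+1 < size o ->
  j \in c' (nth s o n) -> exists2 k, k \in c' (nth s o n.+1) & barrier c0 s o F G j k.
Proof.
move=> vc n1o jn; have no := ltnW n1o.
have [_ _ inv] := verification_inv c0_sep o_avoids vc.
have [sub1 _] := inv _ (nth_o n1o).
have [_ /(_ _ jn)[jn0|[js [_ [c1 [tb Ed subc1]]]]]] := inv _ (nth_o no).
  have prio : priority (c0 (nth s o n.+1)) <= j.
    apply: leq_trans (priority_le jn0).
    by move/(sortedP s): (proj2 o_sorted) => /(_ _ n1o).
  have [k kn Ek] := priority_attained (leq_ltn_trans prio (ltn_ord j)).
  exists k; first exact: sub1.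
  right; split; [exact: other_G (nth_o no)|exact: other_G (nth_o n1o)|].
  by rewrite -Ek.
have [o1 [o2 [Eo _ no2]]] := destination_Some Ed.
have Hn : n = size o1.
  apply/eqP; rewrite -(nth_uniq s no _ o_uniq); last first.
    by rewrite Eo size_cat /= addnS ltnS leq_addr.
  by apply/eqP; rewrite [in RHS]Eo nth_cat ltnn subnn.
have /hasP[k kc1 kj] : has (fun k : 'I_B => k < j) (c1 (nth s o n.+1)).
  have n1o2 : 0 < size o2.
    by move: n1o; rewrite Eo size_cat /= -Hn -addn1 ltn_add2l.
  apply: no2; rewrite Eo nth_cat ltnNge Hn leqnSn /= subSn // subnn /=.
  exact: mem_nth.
exists k; first by apply: subc1 kc1; apply: nth_o.
left; split=> //; first by rewrite -mem_c0s.
by exists c1, (nth s o n.+1); split=> //; apply: nth_o.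
Qed.

Lemma next_pick p : picks c s F G o p -> size p <= size o ->
  exists k, picks c s F G o (rcons p k).
Proof.
case=> {p} [_|j c' st|p j k j0 c' pj po st kn bar].
- by have [j [c' st]] := stop_exists; exists j; apply: picks_first st.
- rewrite /= => o0; have [tb Ed] := (st).
  have /hasP[k k0 kj] := destination_None Ed (mem_nth s o0).
  exists k; apply: (picks_next (p := [::]) (picks_first st) _ st) => //.
  left; split=> //; first exact: stops_at_source st.
  by exists c', (nth s o 0); split=> //; apply: nth_o.
- rewrite !size_rcons => n1o.
  have [k' kn' bar'] := next_barrier (proj1 (proj1 st)) n1o kn.
  exists k'; apply: (picks_next (picks_next pj po st kn bar) _ st _ bar');
  by rewrite size_rcons.
Qed.

Let dominates (x y : 'I_B) : bool :=
  if x \in F then (y < x) && ((y \in G) || (y \in F) && (y \in above (c s) x))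
  else [&& x \in G, y \in G & y <= x].

Let G_notin_F b : b \in G -> (b \in F) = false.
Proof. by move=> bG; apply: contraNF (G_source bG) => /F_source. Qed.

Lemma dominates_trans : transitive dominates.
Proof.
rewrite /dominates => y x z; case: ifP => xF; last first.
  case/and3P=> -> yG yx; rewrite G_notin_F // => /and3P[_ -> zy].
  exact: leq_trans zy yx.
case/andP=> yx /orP[yG|/andP[yF yabove]].
  rewrite G_notin_F // => /and3P[_ -> zy]; by rewrite (leq_ltn_trans zy yx).
rewrite yF => /andP[zy]; rewrite (ltn_trans zy yx) /=.
case/orP=> [->//|/andP[-> zabove]]; apply/orP; right.
move: yabove zabove; rewrite /above !mem_above => /andP[_ yx'] /andP[-> zy'].
exact: ltn_trans zy' yx'.
Qed.

Lemma barrier_dominates j k c' t : verification c0 s o c' -> t != s ->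
  k \in c' t -> barrier c0 s o F G j k -> dominates j k.
Proof.
move=> vc ts kt [[jF kj [c1 [u [[vc1 hj] us ku]]]]|[jG kG kj]]; last first.
  by rewrite /dominates G_notin_F // jG kG.
rewrite /dominates jF kj /=.
have [_ [q Eq] inv] := verification_inv c0_sep o_avoids vc1.
have [_ /(_ _ ku)[ku0|[ks [nks _]]]] := inv _ us; first by rewrite (other_G ku0).
move: (ks); rewrite mem_c0s => kF; rewrite kF orbC /=.
have jc0 : j \in c0 s by rewrite mem_c0s.
have : k \in above (c0 s) j.
  have [r Er] : exists r, c1 s = j :: r.
    by case: (c1 s) hj => // y r [->]; exists r.
  have jq : j \notin q.
    move: (proj1 c0_sep s); rewrite Eq Er cat_uniq /= negb_or.
    by case/and3P=> _ /andP[].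
  rewrite /above Eq Er take_index_cat //.
  by move: ks; rewrite Eq mem_cat (negbTE nks) orbF.
rewrite /c0 ffunE above_filter ?F_source ?inE ?jF //.
by rewrite mem_filter => /andP[_ ->].
Qed.

Let picked_from p n := nth i p n \in F \/
  [/\ 0 < n, nth i p n \in G & nth i p n \in c0 (nth s o n.-1)].

Lemma picks_inv p : picks c s F G o p -> size p <= (size o).+1 ->
  sorted dominates p /\ forall n, n < size p -> picked_from p n.
Proof.
elim=> {p} [_|j c' st _|p j k j0 c' pj IH po st kn bar _] //.
  by split=> // [[|//] _]; left; apply: stops_at_source st.
rewrite size_rcons in IH; have [srt from] := IH (leqW po).
have ons := nth_o po; have vc := proj1 (proj1 st).
have [_ _ inv] := verification_inv c0_sep o_avoids vc.
split.
  have := barrier_dominates vc ons kn bar.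
  move: srt; case: p {IH pj po kn ons from} => [|x p] /=; first by move=> _ ->.
  by rewrite [path _ x (rcons _ k)]rcons_path last_rcons => -> ->.
move=> n; rewrite size_rcons ltnS leq_eqVlt => /predU1P[->|np].
  rewrite /picked_from nth_rcons ltnn eqxx size_rcons /=.
  have [_ /(_ _ kn)[kn0|[ks _]]] := inv _ ons.
    by right; split=> //; apply: other_G kn0 ons.
  by left; rewrite -mem_c0s.
by rewrite /picked_from nth_rcons np; apply: from; rewrite size_rcons in np.
Qed.

Let nth_o_neq m n : 0 < m -> m < n -> n <= size o ->
  nth s o m.-1 != nth s o n.-1.
Proof.
case: m n => [|m] [|n] //= _ mn no.
have mn' : m < n by [].
by rewrite (nth_uniq s (ltn_trans mn' no) no o_uniq) ltn_eqF.
Qed.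

Lemma picks_distinct p m n : picks c s F G o p -> size p <= (size o).+1 ->
  m < n < size p -> nth i p m != nth i p n.
Proof.
move=> pp po /andP[mn np]; have [srt from] := picks_inv pp po.
have mp := ltn_trans mn np.
have := sorted_ltn_nth dominates_trans i srt _ _ mp np mn; rewrite /dominates.
case: ifP => [_ /andP[+ _]|mF _]; first by apply: contraTneq => ->; rewrite ltnn.
case: (from _ mp) => [|[m0 mG mo]]; first by rewrite mF.
case: (from _ np) => [nF|[n0 nG no]]; first by apply: contraFneq mF => ->.
apply: contraNneq (nth_o_neq m0 mn (leq_trans np po)) => Emn.
by rewrite -Emn in no; rewrite (proj2 c0_sep _ _ _ mo no).
Qed.

Lemma picks_uniq p : picks c s F G o p -> size p <= (size o).+1 -> uniq p.
Proof.
move=> pp po; apply/(uniqP i) => m n mp np /eqP Emn; apply/eqP.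
case: ltngtP Emn => // [mn|nm].
  by rewrite (negbTE (picks_distinct pp po _)) ?mn.
by rewrite eq_sym (negbTE (picks_distinct pp po _)) ?nm.
Qed.

Lemma picks_sub p : picks c s F G o p -> size p <= (size o).+1 ->
  {subset p <= F :|: G}.
Proof.
move=> pp po b /(nthP i)[n np <-]; have [_ /(_ n np)] := picks_inv pp po.
by rewrite inE => -[->//|[_ -> _]]; rewrite orbT.
Qed.

(* If all picked blocks of F became well placed, their destinations together
   with the stacks of the picked blocks of G would be S distinct stacks among
   the S - 1 stacks other than s. *)
Lemma picks_P8 p : picks c s F G o p -> size p = (size o).+1 ->
  P8 c i s ([set b in p] :&: F) ([set b in p] :&: G).
Proof.
move=> pp Ep; have po : size p <= (size o).+1 by rewrite Ep.
have [srt from] := picks_inv pp po; have [ic FP GP G1 _] := FG_P8.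
split=> // [b|b|t ts|e es]; first by rewrite inE => /andP[_ /FP].
- by rewrite inE => /andP[_ /GP].
- apply: leq_trans (G1 t ts); apply/subset_leq_card/subsetP => b.
  by rewrite !inE => /andP[/andP[_ ->]].
set X := [set b in p] :&: F :|: [set b in p] :&: G.
have [/exists_inP//|/exists_inPn wp] := boolP [exists b in [set b in p] :&: F,
  ~~ well_placed (after_relocating (restrict c X) s e b) b].
have pX b : b \in p -> b \in X.
  by move=> bp; have := picks_sub pp po bp; rewrite !inE bp.
pose pos n := if nth i p n \in F then e (nth i p n) else nth s o n.-1.
have pos_o n : n < size p -> pos n \in o.
  move=> np; rewrite /pos; case: ifP => nF.
    by rewrite mem_o es // !inE mem_nth.
  have [|[n0 _ _]] := from n np; first by rewrite nF.
  by rewrite mem_nth //; case: n n0 np {nF} => // n _; rewrite Ep.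
have pos_neq m n : m < n -> n < size p -> pos m != pos n.
  move=> mn np; have mp := ltn_trans mn np.
  have := sorted_ltn_nth dominates_trans i srt _ _ mp np mn; rewrite /dominates /pos.
  case: ifP => mF; last first.
    case/and3P=> _ nG _; rewrite G_notin_F //.
    have [|[m0 _ _]] := from m mp; first by rewrite mF.
    by rewrite nth_o_neq // -ltnS -Ep.
  set x := nth i p m; set y := nth i p n => /andP[yx yx_src].
  have xp : x \in p := mem_nth i mp; have yp : y \in p := mem_nth i np.
  have := wp x; rewrite !inE xp mF => /(_ isT).
  rewrite after_relocatingE well_placed_relocate negbK => /hasPn noy.
  apply/eqP => Epos; have := yx; apply/negP/noy; rewrite Epos.
  have -> : above (restrict c X s) x = [seq b <- above (c s) x | b \in X].
    by rewrite ffunE above_filter ?pX ?F_source.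
  case: ifP yx_src => [yF|yF].
    case/orP=> [yG|/= ya]; first by rewrite G_notin_F in yF.
    by apply: run_moved; rewrite mem_filter pX.
  rewrite orbF => yG; have [|[_ _ yo]] := from n np; first by rewrite -/y yF.
  apply: run_keep; first by rewrite ffunE mem_filter pX //; move: yo; rewrite mem_c0 => /andP[].
  rewrite mem_filter negb_and; apply/orP; right.
  by apply: contra (G_source yG) => /mem_take.
have : size [seq pos n | n <- iota 0 (size p)] <= size o.
  apply: uniq_leq_size => [|t /mapP[n]]; last first.
    by rewrite mem_iota => /= np ->; apply: pos_o.
  rewrite map_inj_in_uniq ?iota_uniq // => m n; rewrite !mem_iota /= => mp np /eqP.
  apply: contraTeq; rewrite neq_ltn => /orP[mn|nm]; first exact: pos_neq.
  by rewrite eq_sym pos_neq.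
by rewrite size_map size_iota Ep ltnn.
Qed.
End Picks.

Theorem mainTheorem13 (S B : nat) (c : config S B) (i : 'I_B) (s : 'I_S)
    (F G : {set 'I_B}) (o : seq 'I_S) :
  is_initial c ->
  P8 c i s F G ->
  sorted_stacks (restrict c (F :|: G)) s o ->
  (forall p : seq 'I_B, picks c s F G o p -> size p < S ->
     exists k : 'I_B, picks c s F G o (rcons p k)) /\
  (forall p : seq 'I_B, picks c s F G o p -> size p = S ->
     [/\ #|[set b in p]| = S,
         [set b in p] \subset F :|: G
       & P8 c i s ([set b in p] :&: F) ([set b in p] :&: G)]).
Proof.
move=> ic P8FG so; have Eo := size_sorted_stacks so.
split=> p pp Ep; first by apply: (next_pick ic P8FG so pp); rewrite -ltnS Eo.
have Epo : size p = (size o).+1 by rewrite Eo.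
have po : size p <= (size o).+1 by rewrite Epo.
split; last exact: (picks_P8 ic P8FG so pp Epo).
  by rewrite cardsE -[RHS]Ep; apply/card_uniqP/(picks_uniq ic P8FG so pp po).
by apply/subsetP => b; rewrite inE; apply: (picks_sub ic P8FG so pp po).
Qed.
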